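(* In the setting described in the context, let $\tilde e(t)=\alpha^*(t)-\hat\alpha(t)$. Suppose $\alpha^*(t)<0$ and $\varrho(t)\ge0$ for all $t\in I$, where $I\subset\mathbb R_{\ge0}$ is some (unknown) time interval. If the trajectory $x(t;x(0))$ satisfies the consolidating constraint $\rho_\alpha(t)<\alpha(t,x_1(t;x(0)))$ for all $t\ge0$ with $$\rho_\alpha(t)=\iota(t)\varrho(t)+(1-\iota(t))(\hat\alpha(t)-\mu),$$ then $x(t;x(0))$ is a least violating solution with the gap $\mu^*=\tilde e+\mu$, i.e. $$\alpha^*(t)-\mu^*<\alpha(t,x_1(t;x(0)))\quad\text{for all }t\in I,\qquad \mu^*=\tilde e(t)+\mu>0.$$
   Context: $h=[h_1,\dots,h_m]^\top:\mathbb R_{\ge0}\times\mathbb R^n\to\mathbb R^m$ is the output map, $C^2$ in $x_1\in\mathbb R^n$ and $C^1$ in $t$, of a control system with state $x\in\mathbb R^{nr}$, whose first block of components is $x_1\in\mathbb R^n$; $x(t;x(0))$ is the state trajectory from $x(0)$ and $x_1(t;x(0))$ its $x_1$-component. Output constraints $\underline\rho_i(t)<h_i(t,x_1)<\overline\rho_i(t)$, $1\le i\le m$: for $1\le i\le p$ both bounds are bounded $C^1$ functions with bounded derivatives (and $\overline\rho_i-\underline\rho_i\ge\epsilon_i>0$); for $p+1\le i\le p+q$ only $\underline\rho_i$ is finite (bounded $C^1$ with bounded derivative, $\overline\rho_i\equiv+\infty$); for $p+q+1\le i\le m$ only $\overline\rho_i$ is finite (bounded $C^1$ with bounded derivative,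 $\underline\rho_i\equiv-\infty$). Define $\psi_{2i-1}=h_i-\underline\rho_i$, $\psi_{2i}=\overline\rho_i-h_i$ for $1\le i\le p$; $\psi_{p+j}=h_j-\underline\rho_j$ for $p+1\le j\le p+q$; $\psi_{p+j}=\overline\rho_j-h_j$ for $p+q+1\le j\le m$. For a fixed $\nu>0$, $\alpha(t,x_1)=-\frac1\nu\ln\big(\sum_{i=1}^{m+p}e^{-\nu\psi_i(t,x_1)}\big)$. It is assumed that $-\min_i\psi_i(t,x_1)\to+\infty$ as $\|x_1\|\to\infty$, uniformly in $t\ge 0$, so that $\alpha^*(t)=\max_{x_1\in\mathbb R^n}\alpha(t,x_1)$ exists. Estimator: $\hat\alpha(t)=\alpha(t,\tilde x_1(t))$, where $\tilde x_1(t)\in\mathbb R^n$ solves, from an arbitrary $\tilde x_1(0)$, $$\dot{\tilde x}_1=k_\alpha\nabla_{\tilde x_1}\alpha-\frac{\nabla_{\tilde x_1}\alpha}{\|\nabla_{\tilde x_1}\alpha\|^2+\epsilon_g\,\chi(\|\nabla_{\tilde x_1}\alpha\|)}\,\frac{\partial\alpha}{\partial t}$$ with $\alpha$ and its derivatives evaluated at $(t,\tilde x_1)$, constants $k_\alpha,\epsilon_g,\mu_\chi>0$, and $\chi(z)=1$ for $z<0$, $\chi(z)=\frac{2}{\mu_\chi^3}z^3-\frac{3}{\mu_\chi^2}z^2+1$ for $0\le z\le\mu_\chi$, $\chi(z)=0$ for $z>\mu_\chi$. Nominal lower bound: $\varrho(t)=\left(\frac{T-t}{T}\right)^{\frac1{1-\beta}}(\varrho_0-\varrho_\infty)+\varrho_\infty$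 for $0\le t<T$ and $\varrho(t)=\varrho_\infty$ for $t\ge T$, where $T>0$, $\beta\in(0,1)$, $\varrho_\infty\ge0$, $\varrho_0<\alpha(0,x_1(0))$. $\mu>0$ is a constant. With $\varphi(t)=\hat\alpha(t)-\varrho(t)$: $\iota(t)=1$ if $\varphi(t)>\mu$; $\iota(t)=-\frac{2}{\mu^3}\varphi(t)^3+\frac{3}{\mu^2}\varphi(t)^2$ if $0\le\varphi(t)\le\mu$; $\iota(t)=0$ if $\varphi(t)<0$. Least violating solution: when $\alpha^*(t)<0$ for $t\in I$, $x(t;x(0))$ is called a least violating solution with a given gap $\mu^*>0$ if $\alpha^*(t)-\mu^*<\alpha(t,x_1(t;x(0)))$ for all $t\in I$. (Here the gap $\mu^*=\tilde e+\mu$ may depend on $t$ through $\tilde e$.) *)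

(* Defs.v *)
From mathcomp Require Import all_boot all_order all_algebra.
From mathcomp Require Import all_classical all_reals all_analysis.
From mathcomp Require Import zify.

Set Implicit Arguments.
Unset Strict Implicit.
Unset Printing Implicit Defensive.

Import Order.TTheory GRing.Theory Num.Theory.
Import numFieldNormedType.Exports.

Local Open Scope classical_set_scope.
Local Open Scope ring_scope.

(* Functions of time are total on R; only their values on [0, +oo[ matter. *)

Notation time_ge0 := `[0%R, +oo[%classic.

(* The library norm of 'rV[R]_n is the sup norm. *)
Definition euclid_norm (R : realType) (n : nat) (v : 'rV[R]_n) : R :=
  Num.sqrt (\sum_(j < n) v 0 j ^+ 2).

Definition grad (R : realType) (n : nat) (f : 'rV[R]_n -> R) (x : 'rV[R]_n) :
    'rV[R]_n :=
  \row_(j < n) 'D_('e_j) f x.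

Definition C1_space (R : realType) (n : nat) (f : 'rV[R]_n -> R) : Prop :=
  (forall x, differentiable f x) /\
  (forall j : 'I_n, continuous (fun x => grad f x 0 j)).

Definition C2_space (R : realType) (n : nat) (f : 'rV[R]_n -> R) : Prop :=
  C1_space f /\ forall j : 'I_n, C1_space (fun x => grad f x 0 j).

(* df is the derivative of f on ]0, +oo[, extended continuously to 0; it is
   then also the one-sided derivative of f at 0. *)
Definition C1_time_with (R : realType) (f df : R -> R) : Prop :=
  [/\ {within time_ge0, continuous f},
      {within time_ge0, continuous df} &
      forall t : R, 0 < t -> is_derive t 1 f (df t)].

Definition C1_time (R : realType) (f : R -> R) : Prop :=
  exists df, C1_time_with f df.

Definition bounded_C1_time (R : realType) (f : R -> R) : Prop :=
  exists df M, C1_time_with f df /\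
    forall t, 0 <= t -> `|f t| <= M /\ `|df t| <= M.

Definition finite_bound (R : realType) (b : R -> \bar R) : Prop :=
  (forall t, 0 <= t -> b t \is a fin_num) /\
  bounded_C1_time (fun t => fine (b t)).

Definition output_bounds (R : realType) (m p q : nat)
    (lo up : 'I_m -> R -> \bar R) : Prop :=
  [/\ forall i : 'I_m, (i < p)%N ->
        [/\ finite_bound (lo i), finite_bound (up i) &
            exists2 eps : R, 0 < eps &
              forall t, 0 <= t -> (eps%:E <= up i t - lo i t)%E],
      forall i : 'I_m, (p <= i < p + q)%N ->
        finite_bound (lo i) /\ forall t, 0 <= t -> up i t = +oo%E &
      forall i : 'I_m, (p + q <= i)%N ->
        finite_bound (up i) /\ forall t, 0 <= t -> lo i t = -oo%E].

(* Numbering from 0 of the m + p functions psi: for i < p, the functions 2i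
   and 2i+1 come from the lower and the upper bound of output i; for p <= j < m,
   the function p + j comes from the only finite bound of output j. *)

Lemma psi_output_subproof (m p q : nat) (hpq : (p + q <= m)%N)
    (k : 'I_(m + p)) : ((if k < p.*2 then k./2 else k - p) < m)%N.
Proof. case: ifP; have := ltn_ord k; lia. Qed.

Definition psi_output (m p q : nat) (hpq : (p + q <= m)%N) (k : 'I_(m + p)) :
    'I_m :=
  Ordinal (psi_output_subproof hpq k).

Definition psi_lower (p q k : nat) : bool :=
  if (k < p.*2)%N then ~~ odd k else (k - p < p + q)%N.

Definition psi (R : realType) (n m p q : nat) (hpq : (p + q <= m)%N)
    (h : R -> 'rV[R]_n -> 'rV[R]_m) (lo up : 'I_m -> R -> \bar R)
    (k : 'I_(m + p)) (t : R) (x : 'rV[R]_n) : R :=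
  let i := psi_output hpq k in
  if psi_lower p q k then h t x 0 i - fine (lo i t)
  else fine (up i t) - h t x 0 i.

Definition smooth_min (R : realType) (n N : nat) (nu : R)
    (ps : 'I_N -> R -> 'rV[R]_n -> R) (t : R) (x : 'rV[R]_n) : R :=
  - nu^-1 * ln (\sum_(k < N) expR (- nu * ps k t x)).

(* The minimum of the empty family is +oo. *)
Definition family_min (R : realType) (n N : nat)
    (ps : 'I_N -> R -> 'rV[R]_n -> R) (t : R) (x : 'rV[R]_n) : \bar R :=
  \big[Order.min/+oo%E]_(k < N) (ps k t x)%:E.

Definition unif_radially_unbounded (R : realType) (n : nat)
    (V : R -> 'rV[R]_n -> \bar R) : Prop :=
  forall M : R, exists K : R, forall t x,
    0 <= t -> K < euclid_norm x -> (M%:E < V t x)%E.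

(* The maximum of f; a default value if f does not attain a maximum. *)
Definition max_value (R : realType) (T : Type) (f : T -> R) : R :=
  get [set a : R | (exists x, f x = a) /\ forall x, f x <= a].

Definition chi (R : realType) (mu_chi z : R) : R :=
  if z < 0 then 1
  else if z <= mu_chi then
    2 / mu_chi ^+ 3 * z ^+ 3 - 3 / mu_chi ^+ 2 * z ^+ 2 + 1
  else 0.

Definition estimator_rhs (R : realType) (n : nat) (k_alpha eps_g mu_chi : R)
    (alpha : R -> 'rV[R]_n -> R) (t : R) (x : 'rV[R]_n) : 'rV[R]_n :=
  let g := grad (alpha t) x in
  let dalpha_dt := derive1 (fun s => alpha s x) t in
  k_alpha *: g
  - (dalpha_dt / (euclid_norm g ^+ 2 + eps_g * chi mu_chi (euclid_norm g)))
      *: g.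

Definition classical_solution (R : realType) (n : nat)
    (F : R -> 'rV[R]_n -> 'rV[R]_n) (y0 : 'rV[R]_n) (y : R -> 'rV[R]_n) :
    Prop :=
  [/\ y 0 = y0,
      {within time_ge0, continuous y} &
      forall t : R, 0 < t -> is_derive t 1 y (F t (y t))].

Definition caratheodory_solution (R : realType) (n : nat)
    (F : R -> 'rV[R]_n -> 'rV[R]_n) (y0 : 'rV[R]_n) (y : R -> 'rV[R]_n) :
    Prop :=
  y 0 = y0 /\
  forall t (j : 'I_n), 0 <= t ->
    (@lebesgue_measure R).-integrable `[0, t]
      (fun s => (F s (y s) 0 j)%:E) /\
    y t 0 j = y0 0 j
      + (\int[@lebesgue_measure R]_(s in `[0, t]) F s (y s) 0 j)%R.

(* A state in R^(nr) is a row of r consecutive blocks of length n. *)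
Definition first_block (R : realType) (n r : nat) (hr : (0 < r)%N)
    (x : 'rV[R]_(r * n)) : 'rV[R]_n :=
  row (Ordinal hr) (vec_mx x).

Definition nominal_bound (R : realType) (T beta rho_0 rho_inf t : R) : R :=
  if t < T then
    ((T - t) / T) `^ (1 / (1 - beta)) * (rho_0 - rho_inf) + rho_inf
  else rho_inf.

Definition switch (R : realType) (mu z : R) : R :=
  if mu < z then 1
  else if 0 <= z then - (2 / mu ^+ 3) * z ^+ 3 + 3 / mu ^+ 2 * z ^+ 2
  else 0.

(* a is the trajectory of alpha along the solution. *)
Definition least_violating (R : realType) (I : set R)
    (alpha_star gap a : R -> R) : Prop :=
  forall t, I t ->
    [/\ alpha_star t < 0, 0 < gap t & alpha_star t - gap t < a t].

(* Main.v *)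
(* The smooth minimum lies below every psi_k, so the coercivity hypothesis makes
   alpha(t, .) coercive: it attains its maximum, and alpha_hat <= alpha_star.
   On I this gives alpha_hat <= alpha_star < 0 <= varrho, so the switch iota
   vanishes and rho_alpha = alpha_hat - mu = alpha_star - (e + mu). *)

Require Import Defs.
From mathcomp Require Import all_boot all_order all_algebra.
From mathcomp Require Import all_classical all_reals all_analysis.
Import Order.TTheory GRing.Theory Num.Theory.
Import numFieldNormedType.Exports.
Local Open Scope classical_set_scope.
Local Open Scope ring_scope.

(** Bridges two norms: coercivity is stated with the Euclidean norm, whereas compactness of balls is
    used for the sup norm. *)
Lemma le_euclid_norm (R : realType) (n : nat) (v : 'rV[R]_n) :
  `|v| <= euclid_norm v.
Proof.
have v2_ge0 : 0 <= \sum_(j < n) v 0 j ^+ 2 by apply: sumr_ge0 => j _; exact: sqr_ge0.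
rewrite [leLHS]/Num.Def.normr /= mx_normrE; apply: bigmax_le => [|[i j] _ /=].
  exact: sqrtr_ge0.
rewrite ord1 -sqrtr_sqr ler_sqrt // (bigD1 j) //= lerDl.
by apply: sumr_ge0 => k _; exact: sqr_ge0.
Qed.

(** A maximizer over a compact ball containing 0 is global, since outside the ball [g] stays below
    [g 0]. *)
Lemma coercive_max (R : realType) (n : nat) (g : 'rV[R]_n -> R) (K : R) :
  continuous g -> (forall x, K < `|x| -> g x <= g 0) ->
  exists c, forall x, g x <= g c.
Proof.
(* [K] may be negative; the radius [Num.max K 0] keeps 0 in the ball. *)
move=> gc gle; pose A := [set x : 'rV[R]_n | `|x| <= Num.max K 0].
have A0 : A 0 by rewrite /A /= normr0 le_max lexx orbT.
have Ac : compact A.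
  apply: bounded_closed_compact.
    by exists (Num.max K 0); split; [exact: num_real|move=> M KM x /= /le_trans; apply; exact: ltW].
  have -> : A = Num.norm @^-1` [set y : R | y <= Num.max K 0] by [].
  apply: preimage_closed; last exact: closed_le.
  by move=> x _; exact: norm_continuous.
have [c _ cmax] := EVT_max_rV (ex_intro _ _ A0) Ac (continuous_subspaceT gc).
exists c => x; have [xA|] := boolP (x \in A); first exact: cmax.
rewrite notin_setE /A /= => /negP; rewrite -ltNge gt_max => /andP[Kx _].
by apply: (le_trans (gle x Kx)); apply: cmax; rewrite inE.
Qed.

(** A maximizer makes the set behind [get] nonempty, so [max_value f] is a true maximum and not the
    default value. *)
Lemma le_max_value (R : realType) (T : Type) (f : T -> R) (c : T) :
  (forall x, f x <= f c) -> forall x, f x <= max_value f.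
Proof.
move=> fc; rewrite /max_value.
by case: (@getPex _ [set a | (exists x, f x = a) /\ forall x, f x <= a]);
  first by exists (f c); split; [exists c|].
Qed.

Section SmoothMin.
Variables (R : realType) (n N : nat) (nu : R) (ps : 'I_N -> R -> 'rV[R]_n -> R).
Hypothesis nu_gt0 : 0 < nu.

(** Each exponential is at most the whole sum; taking [ln] and multiplying by the negative factor
    [- nu^-1] reverses the inequality. *)
Lemma smooth_min_le (k : 'I_N) t x : smooth_min nu ps t x <= ps k t x.
Proof.
rewrite /smooth_min mulNr lerNl ler_pdivlMl // mulrN -mulNr -[leLHS]expRK.
have le_k : expR (- nu * ps k t x) <= \sum_(j < N) expR (- nu * ps j t x).
  by rewrite (bigD1 k) //= lerDl sumr_ge0 // => j _; exact: expR_ge0.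
by rewrite ler_ln // posrE ?expR_gt0 // (lt_le_trans _ le_k) ?expR_gt0.
Qed.

Lemma continuous_smooth_min t : (0 < N)%N ->
  (forall k, continuous (ps k t)) -> continuous (smooth_min nu ps t).
Proof.
move=> N_gt0 psc x.
have expc k : continuous (fun z => expR (- nu * ps k t z)).
  move=> z; have nu_psc := continuousM (@cst_continuous _ _ (- nu) z) (psc k z).
  exact: (continuous_comp nu_psc (@continuous_expR R _)).
have sumc : continuous (fun z => \sum_(k < N) expR (- nu * ps k t z)).
  by apply: continuous_big => [|k _]; [exact: add_continuous|exact: expc].
have lnc : {for x, continuous (fun z => ln (\sum_(k < N) expR (- nu * ps k t z)))}.
  apply: (continuous_comp (sumc x) (continuous_ln _)).
  (* [ln] is continuous at positive points; the term of index 0 makes the sum positive. *)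
  by rewrite (bigD1 (Ordinal N_gt0)) //= ltr_wpDr ?expR_gt0 // sumr_ge0.
exact: (continuousM (@cst_continuous _ _ (- nu^-1) _) lnc).
Qed.

Lemma smooth_min_attains_max (t : R) : (0 < N)%N -> 0 <= t ->
  (forall k, continuous (ps k t)) ->
  unif_radially_unbounded (fun s z => (- family_min ps s z)%E) ->
  exists c, forall x, smooth_min nu ps t x <= smooth_min nu ps t c.
Proof.
move=> N_gt0 t_ge0 psc coer.
(* With this level, beyond radius [K] the minimum of the family lies below the value of the smooth
   minimum at 0. *)
have [K HK] := coer (- smooth_min nu ps t 0).
apply: (@coercive_max _ _ _ K); first exact: continuous_smooth_min.
move=> x Kx; have := HK t x t_ge0 (lt_le_trans Kx (le_euclid_norm _ _ x)).
(* The default [+oo] cannot lie below a real number, so some [ps k t x] does, and it bounds the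
   smooth minimum at [x] from above. *)
rewrite /family_min EFinN lteN2 => /bigmin_ltP[|[k _]]; first by rewrite ltNge leey.
by rewrite lte_fin => /ltW; exact: (le_trans (smooth_min_le k t x)).
Qed.

End SmoothMin.

Lemma continuous_psi (R : realType) (n m p q : nat) (hpq : (p + q <= m)%N)
    (h : R -> 'rV[R]_n -> 'rV[R]_m) (lo up : 'I_m -> R -> \bar R) t k :
  (forall i, continuous (fun z => h t z 0 i)) -> continuous (psi hpq h lo up k t).
Proof.
move=> hc x; rewrite /psi; case: (psi_lower p q k).
  exact: (continuousB (hc _ x) (@cst_continuous _ _ _ x)).
exact: (continuousB (@cst_continuous _ _ _ x) (hc _ x)).
Qed.

Theorem lemma4 (R : realType) (n r l m p q : nat)
  (hn : (0 < n)%N) (hr : (0 < r)%N) (hm : (0 < m)%N) (hpq : (p + q <= m)%N)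
  (* control system, input and state trajectory *)
  (f : R -> 'rV[R]_(r * n) -> 'rV[R]_l -> 'rV[R]_(r * n))
  (u : R -> 'rV[R]_l) (x0 : 'rV[R]_(r * n)) (x : R -> 'rV[R]_(r * n))
  (hx : caratheodory_solution (fun t z => f t z (u t)) x0 x)
  (* output map and output constraints *)
  (h : R -> 'rV[R]_n -> 'rV[R]_m)
  (hC2 : forall (t : R) (i : 'I_m), 0 <= t -> C2_space (fun z => h t z 0 i))
  (hC1 : forall (z : 'rV[R]_n) (i : 'I_m), C1_time (fun t => h t z 0 i))
  (lo up : 'I_m -> R -> \bar R) (hbounds : output_bounds p q lo up)
  (* smooth minimum and its maximum over the space variable *)
  (nu : R) (hnu : 0 < nu)
  (hcoer : unif_radially_unbounded
             (fun t z => (- family_min (psi hpq h lo up) t z)%E))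
  (alpha := smooth_min nu (psi hpq h lo up))
  (alpha_star := fun t : R => max_value (alpha t))
  (* estimator *)
  (k_alpha eps_g mu_chi : R)
  (hk : 0 < k_alpha) (heps : 0 < eps_g) (hmuchi : 0 < mu_chi)
  (xt0 : 'rV[R]_n) (xt : R -> 'rV[R]_n)
  (hxt : classical_solution (estimator_rhs k_alpha eps_g mu_chi alpha) xt0 xt)
  (alpha_hat := fun t : R => alpha t (xt t))
  (* nominal and consolidating lower bounds *)
  (T beta rho_0 rho_inf mu : R)
  (hT : 0 < T) (hbeta : 0 < beta < 1) (hrho_inf : 0 <= rho_inf)
  (hrho_0 : rho_0 < alpha 0 (first_block hr x0)) (hmu : 0 < mu)
  (varrho := nominal_bound T beta rho_0 rho_inf)
  (iota := fun t : R => switch mu (alpha_hat t - varrho t))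
  (rho_alpha := fun t : R =>
     iota t * varrho t + (1 - iota t) * (alpha_hat t - mu))
  (e := fun t : R => alpha_star t - alpha_hat t)
  (* time interval *)
  (I : set R) (hI : is_interval I) (hI0 : I `<=` [set t : R | 0 <= t])
  (hastar : forall t, I t -> alpha_star t < 0)
  (hvarrho : forall t, I t -> 0 <= varrho t)
  (hcons : forall t : R, 0 <= t -> rho_alpha t < alpha t (first_block hr (x t))) :
  least_violating I alpha_star (fun t => e t + mu)
    (fun t => alpha t (first_block hr (x t))).
Proof.
move=> t It.
have t_ge0 : 0 <= t := hI0 t It.
have [c cmax] : exists c, forall z, alpha t z <= alpha t c.
  apply: smooth_min_attains_max => //; first by rewrite ltn_addr.
  move=> k; apply: continuous_psi => i z.
  exact: differentiable_continuous ((hC2 t i t_ge0).1.1 z).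
have hat_le : alpha_hat t <= alpha_star t := le_max_value _ _ _ _ cmax (xt t).
have hat_lt : alpha_hat t - varrho t < 0.
  rewrite subr_lt0; apply: le_lt_trans hat_le _.
  exact: lt_le_trans (hastar t It) (hvarrho t It).
have iota0 : iota t = 0.
  (* A negative argument is below 0 and below [mu], which selects the last branch of [switch]. *)
  by rewrite /iota /switch ltNge (le_trans (ltW hat_lt) (ltW hmu)) /= leNgt hat_lt.
split; first exact: hastar.
  (* The gap is positive because [e t] is nonnegative by [hat_le] and [mu] is positive. *)
  by rewrite ltr_wpDl // subr_ge0.
have := hcons t t_ge0; rewrite /rho_alpha iota0 mul0r add0r subr0 mul1r.
by rewrite /e opprD opprB addrA subrKC.
Qed.
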